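(* Let $(W,\mathrm{d})$ be a closed Hilbert complex with domain complex $(V,\mathrm{d})$, fix a degree $k$, and let $F\colon V^k\to W^k$ be a (possibly nonlinear) operator that is monotone and hemicontinuous. Then for every $f\in W^k$ the semilinear problem $$\mathbf{L}\mathbf{u}+F\mathbf{u}=f$$ has a unique solution $\mathbf{u}\in D_L$. Moreover, the problem is well-posed: given $f,f'\in W^k$, the respective solutions $\mathbf{u}$ and $\mathbf{u}'$ satisfy the Lipschitz continuity estimate $$\|\mathbf{u}-\mathbf{u}'\|_{V\cap V^*}\le\|\mathbf{K}\|\,\|f-f'\|.$$
   Context: All Hilbert spaces are real. A Hilbert complex $(W,\mathrm{d})$ is a sequence of Hilbert spaces $W^k$ with closed, densely defined linear maps $\mathrm{d}^k\colon V^k\subset W^k\to V^{k+1}\subset W^{k+1}$ (possibly unbounded) such that $\mathrm{d}^k\circ\mathrm{d}^{k-1}=0$. It is closed if each image $\mathrm{d}^kV^k$ is closed in $W^{k+1}$. The inner product and norm of $W^k$ are written $\langle\cdot,\cdot\rangle$, $\|\cdot\|$. The domain complex $(V,\mathrm{d})$ consists of the domains $V^k$ with the graph inner product $\langle u,v\rangle_V=\langle u,v\rangle+\langle\mathrm{d}^ku,\mathrm{d}^kv\rangle$. Put $\mathfrak{Z}^k=\ker\mathrm{d}^k$, $\mathfrak{B}^k=\mathrm{d}^{k-1}V^{k-1}$, and $\mathfrak{H}^k=\mathfrak{Z}^k\cap\mathfrak{B}^{k\perp}$ (harmonic space); $P_{\mathfrak{H}}$ is the orthogonal projection of $W^k$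 onto $\mathfrak{H}^k$. The adjoint $\mathrm{d}^*_k=(\mathrm{d}^{k-1})^*$ has domain $V_k^*\subset W^k$ and maps into $W^{k-1}$. Degree indices on $\mathrm{d},\mathrm{d}^*$ are suppressed. The abstract Hodge Laplacian is $L=\mathrm{d}\mathrm{d}^*+\mathrm{d}^*\mathrm{d}$, with domain $D_L=\{u\in V^k\cap V_k^*:\mathrm{d}u\in V_{k+1}^*,\ \mathrm{d}^*u\in V^{k-1}\}$. Set $\mathbf{L}=L+P_{\mathfrak{H}}\colon D_L\to W^k$; it is a bijection, with inverse $\mathbf{K}=\mathbf{L}^{-1}$. The space $V^k\cap V_k^*$ is given the inner product $$\langle u,v\rangle_{V\cap V^*}=\langle\mathrm{d}^*u,\mathrm{d}^*v\rangle+\langle\mathrm{d}u,\mathrm{d}v\rangle+\langle P_{\mathfrak{H}}u,P_{\mathfrak{H}}v\rangle$$ with norm $\|\cdot\|_{V\cap V^*}$ (equivalent to the usual intersection norm). $\|\mathbf{K}\|$ is the operator norm of $\mathbf{K}$ as a bounded map from $W^k$ to $(V^k\cap V_k^*,\|\cdot\|_{V\cap V^*})$. $F\colon V^k\to W^k$ is monotone if $\langle Fu-Fv,u-v\rangle\ge0$ for all $u,v\in V^k$, and hemicontinuous if for all $u,v\in V^k$, $w\in W^k$ the real function $t\mapsto\langle F(u+tv),w\rangle$ is continuous on $[0,1]$. *)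

(* Defs.v *)
From HB Require Import structures.
From mathcomp Require Import all_boot all_order all_algebra.
From mathcomp Require Import all_classical all_reals all_analysis.

Set Implicit Arguments.
Unset Strict Implicit.
Unset Printing Implicit Defensive.

Import Order.TTheory GRing.Theory Num.Theory.
Import numFieldNormedType.Exports.

Local Open Scope classical_set_scope.
Local Open Scope ring_scope.

(** * Real Hilbert spaces *)

HB.mixin Record isHilbert (R : realType) W of CompleteNormedModule R W := {
  hdot : {dot W for (@idfun R)};
  hdot_normE : forall u : W, hdot u u = `|u| ^+ 2 }.

#[short(type="hilbertType")]
HB.structure Definition Hilbert (R : realType) :=
  { W of isHilbert R W & CompleteNormedModule R W }.

Notation "''[' u , v ]" := (hdot u v) : ring_scope.

Definition orthogonal_set (R : realType) (W : hilbertType R) (S : set W)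
  : set W := [set u | forall v, S v -> '[u, v] = 0].

Definition orthogonal_proj (R : realType) (W : hilbertType R) (S : set W)
  (u : W) : W := xget 0 [set p | S p /\ orthogonal_set S (u - p)].

(** * Possibly unbounded operators *)

(* The values of [op_fun] outside [op_dom] are irrelevant. *)
Record operator (R : realType) (U W : hilbertType R) :=
  Operator { op_dom : set U ; op_fun :> U -> W }.

Section operators.
Context {R : realType} {U W : hilbertType R}.
Implicit Type T : operator U W.

Definition linear_operator T : Prop :=
  op_dom T 0 /\
  forall (a : R) (u v : U), op_dom T u -> op_dom T v ->
    op_dom T (a *: u + v) /\ T (a *: u + v) = a *: T u + T v.

Definition densely_defined T : Prop := dense (op_dom T).

Definition closed_operator T : Prop :=
  closed [set p : U * W | op_dom T p.1 /\ T p.1 = p.2].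

Definition ker_op T : set U := [set u | op_dom T u /\ T u = 0].

Definition im_op T : set W := T @` op_dom T.

(* [adjoint_rel T w z] is "w is in the domain of the adjoint, with value z";
   z is unique when T is densely defined. *)
Definition adjoint_rel T (w : W) (z : U) : Prop :=
  forall v, op_dom T v -> '[T v, w] = '[v, z].

Definition adjoint T : operator W U :=
  Operator [set w | exists z, adjoint_rel T w z]
           (fun w => xget 0 [set z | adjoint_rel T w z]).

Definition inverse_op T : W -> U :=
  fun f => xget 0 [set u | op_dom T u /\ T u = f].

End operators.

(** * Hilbert complexes *)

(* The differential is indexed by a proof of [i + 1 = j], so that both
   [d^k : W^k -> W^(k+1)] and [d^(k-1) : W^(k-1) -> W^k] are available without
   casts. *)
Record hilbertComplex (R : realType) := HilbertComplex {
  cspace :> int -> hilbertType R ;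
  cdiff : forall i j, i + 1 = j -> operator (cspace i) (cspace j) ;
  cdiff_linear : forall i j (e : i + 1 = j), linear_operator (cdiff e) ;
  cdiff_dense : forall i j (e : i + 1 = j), densely_defined (cdiff e) ;
  cdiff_closed : forall i j (e : i + 1 = j), closed_operator (cdiff e) ;
  cdiff_comp : forall i j l (e : i + 1 = j) (e' : j + 1 = l) (u : cspace i),
    op_dom (cdiff e) u -> ker_op (cdiff e') (cdiff e u) }.

Section hodge.
Context {R : realType} (C : hilbertComplex R).

Definition closed_complex : Prop :=
  forall i j (e : i + 1 = j), closed (im_op (cdiff C e)).

Variable k : int.

Definition d_out : operator (C k) (C (k + 1)) := cdiff C (erefl (k + 1)).
Definition d_in : operator (C (k - 1)) (C k) := cdiff C (subrK 1 k).

Definition dstar_out : operator (C k) (C (k - 1)) := adjoint d_in.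
Definition dstar_in : operator (C (k + 1)) (C k) := adjoint d_out.

Definition dom_V : set (C k) := op_dom d_out.
Definition dom_Vstar : set (C k) := op_dom dstar_out.

Definition cocycles : set (C k) := ker_op d_out.
Definition coboundaries : set (C k) := im_op d_in.
Definition harmonic : set (C k) := cocycles `&` orthogonal_set coboundaries.

Definition P_harmonic : C k -> C k := orthogonal_proj harmonic.

Definition D_L : set (C k) :=
  [set u | [/\ dom_V u, dom_Vstar u, op_dom dstar_in (d_out u)
            & op_dom d_in (dstar_out u)]].

Definition hodge_laplacian : operator (C k) (C k) :=
  Operator D_L (fun u => d_in (dstar_out u) + dstar_in (d_out u)).

Definition bold_L : operator (C k) (C k) :=
  Operator D_L (fun u => hodge_laplacian u + P_harmonic u).

Definition bold_K : C k -> C k := inverse_op bold_L.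

Definition dot_VVstar (u v : C k) : R :=
  '[dstar_out u, dstar_out v] + '[d_out u, d_out v]
  + '[P_harmonic u, P_harmonic v].

Definition norm_VVstar (u : C k) : R := Num.sqrt (dot_VVstar u u).

(* [sup] of an unbounded set is 0; here the set is bounded when the complex is
   closed. *)
Definition opnorm_K : R :=
  sup [set norm_VVstar (bold_K f) | f in [set f : C k | `|f| <= 1]].

End hodge.

Arguments d_out {R} C k.
Arguments d_in {R} C k.
Arguments dstar_out {R} C k.
Arguments dstar_in {R} C k.
Arguments dom_V {R} C k.
Arguments dom_Vstar {R} C k.
Arguments cocycles {R} C k.
Arguments coboundaries {R} C k.
Arguments harmonic {R} C k.
Arguments P_harmonic {R} C k u.
Arguments D_L {R} C k.
Arguments hodge_laplacian {R} C k.
Arguments bold_L {R} C k.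
Arguments bold_K {R} C k f.
Arguments dot_VVstar {R} C k u v.
Arguments norm_VVstar {R} C k u.
Arguments opnorm_K {R} C k.

(** * Nonlinear operators *)

Section nonlinear.
Context {R : realType} {W : hilbertType R}.

(* An operator defined on a subspace [D] is a total function of which only the
   values on [D] are used. *)
Definition monotone_on (D : set W) (F : W -> W) : Prop :=
  forall u v, D u -> D v -> 0 <= '[F u - F v, u - v].

Definition hemicontinuous_on (D : set W) (F : W -> W) : Prop :=
  forall u v w, D u -> D v ->
    {within `[0, 1], continuous (fun t : R => '[F (u + t *: v), w] : R)}.

End nonlinear.

(* Main.v *)
(* Let X be V^k `&` V^*_k with the inner product <.,.>_X.  Since all ranges are
   closed, a Poincare inequality makes X complete, and by Riesz K is the map
   with <K g, v>_X = <g, v>.  The equation is thus u + K (F u - f) = 0, where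
   u |-> K (F u - f) is monotone and hemicontinuous on X.  Minty's theorem
   solves it: minimising the Fitzpatrick function of the operator plus half the
   squared norm on X * X only uses completeness and strong convexity, so neither
   a fixed-point theorem nor weak compactness is needed.  For the estimate, e =
   u - u' satisfies |e|_X^2 = <f - f', e> - <F u - F u', e>
   <= <K (f - f'), e>_X. *)
Require Import Defs.
From mathcomp Require Import all_boot all_order all_algebra.
From mathcomp Require Import all_classical all_reals all_analysis.
From mathcomp Require Import ring lra.

Set Implicit Arguments.
Unset Strict Implicit.
Unset Printing Implicit Defensive.

Import Order.TTheory GRing.Theory Num.Theory.
Import numFieldNormedType.Exports.
Local Open Scope classical_set_scope.
Local Open Scope ring_scope.

(** * Minimisation for semi-inner products *)

Definition linear_subspace {R : realType} {E : lmodType R} (D : set E) : Prop :=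
  D 0 /\ forall (a : R) u v, D u -> D v -> D (a *: u + v).

Record semi_inner {R : realType} {E : lmodType R} (b : E -> E -> R) : Prop :=
  SemiInner {
    sip_linear : forall (a : R) x y z, b (a *: x + y) z = a * b x z + b y z ;
    sip_sym : forall x y, b x y = b y x ;
    sip_ge0 : forall x, 0 <= b x x }.

Definition cauchy_wrt {R : realType} {E : lmodType R} (b : E -> E -> R)
    (u : nat -> E) : Prop :=
  forall e : R, 0 < e -> exists N, forall m n, (N <= m)%N -> (N <= n)%N ->
    b (u m - u n) (u m - u n) < e.

Definition cvg_wrt {R : realType} {E : lmodType R} (b : E -> E -> R)
    (u : nat -> E) (p : E) : Prop :=
  forall e : R, 0 < e -> exists N, forall n, (N <= n)%N ->
    b (u n - p) (u n - p) < e.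

Definition complete_wrt {R : realType} {E : lmodType R} (b : E -> E -> R)
    (D : set E) : Prop :=
  forall u : nat -> E, (forall n, D (u n)) -> cauchy_wrt b u ->
  exists2 p, D p & cvg_wrt b u p.

(** Linearity is required on all of [E] but the bound only on [D]: a functional [p |-> '[g, p.1.1]]
    is bounded for [hodge_form] on [hodge_graph], by a Poincare inequality, and in general not on
    the whole product. Squares avoid roots of [b]. *)
Definition bounded_functional {R : realType} {E : lmodType R} (b : E -> E -> R)
    (D : set E) (l : E -> R) : Prop :=
  (forall (a : R) x y, l (a *: x + y) = a * l x + l y) /\
  exists2 M : R, 0 < M & forall x, D x -> l x ^+ 2 <= M * b x x.

Section subspace.
Context {R : realType} {E : lmodType R} {D : set E}.
Hypothesis subD : linear_subspace D.

Lemma subspaceZ a u : D u -> D (a *: u).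
Proof.
by move=> Du; rewrite -[_ *: _]addr0; apply: subD.2 => //; case: subD.
Qed.

Lemma subspaceD u v : D u -> D v -> D (u + v).
Proof. by move=> Du Dv; rewrite -[u]scale1r; apply: subD.2. Qed.

Lemma subspaceN u : D u -> D (- u).
Proof. by rewrite -scaleN1r; exact: subspaceZ. Qed.

Lemma subspaceB u v : D u -> D v -> D (u - v).
Proof. by move=> Du Dv; apply: subspaceD => //; exact: subspaceN. Qed.

End subspace.

Section semi_inner_theory.
Context {R : realType} {E : lmodType R} {b : E -> E -> R}.
Hypothesis bP : semi_inner b.

Lemma sipDl x y z : b (x + y) z = b x z + b y z.
Proof. by rewrite -[x]scale1r (sip_linear bP) scale1r mul1r. Qed.

Lemma sip0l z : b 0 z = 0.
Proof. by have := sipDl 0 0 z; rewrite addr0 => h; lra. Qed.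

Lemma sipZl a x z : b (a *: x) z = a * b x z.
Proof. by rewrite -[a *: x]addr0 (sip_linear bP) sip0l addr0. Qed.

Lemma sipNl x z : b (- x) z = - b x z.
Proof. by rewrite -scaleN1r sipZl mulN1r. Qed.

Lemma sipDr x y z : b z (x + y) = b z x + b z y.
Proof. by rewrite !(sip_sym bP z) sipDl. Qed.

Lemma sipZr a x z : b z (a *: x) = a * b z x.
Proof. by rewrite !(sip_sym bP z) sipZl. Qed.

Lemma sipNr x z : b z (- x) = - b z x.
Proof. by rewrite !(sip_sym bP z) sipNl. Qed.

Lemma sipBl x y z : b (x - y) z = b x z - b y z.
Proof. by rewrite sipDl sipNl. Qed.

Lemma sip0r z : b z 0 = 0.
Proof. by rewrite (sip_sym bP) sip0l. Qed.

Definition sipE := (sipDl, sipDr, sipZl, sipZr, sipNl, sipNr, sip0l, sip0r).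

Lemma sip_cauchy_schwarz x y : b x y ^+ 2 <= b x x * b y y.
Proof.
have hx := sip_ge0 bP x; have hy := sip_ge0 bP y.
have [y0|y0] := ltP 0 (b y y).
  have := sip_ge0 bP (b y y *: x - b x y *: y).
  rewrite !sipE (sip_sym bP y x) => h.
  have : 0 <= b y y * (b x x * b y y - b x y ^+ 2) by nra.
  by rewrite pmulr_rge0// subr_ge0.
have {}y0 : b y y = 0 by lra.
rewrite y0 mulr0; have [->|xy0] := eqVneq (b x y) 0; first by rewrite expr0n.
(* As [b y y = 0], this multiple of [y] gives the vector the square [-1], a contradiction. *)
have := sip_ge0 bP (x - ((b x x + 1) / (2 * b x y)) *: y).
rewrite !sipE (sip_sym bP y x) y0 !mulr0 oppr0 subr0.
have -> : (b x x + 1) / (2 * b x y) * b x y = (b x x + 1) / 2 by field.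
lra.
Qed.

Lemma sip_sum3_le x y z :
  b (x + y + z) (x + y + z) <= 3 * (b x x + b y y + b z z).
Proof.
have := sip_ge0 bP (x - y); have := sip_ge0 bP (x - z).
have := sip_ge0 bP (y - z); rewrite !sipE.
rewrite (sip_sym bP z x) (sip_sym bP y x) (sip_sym bP z y); lra.
Qed.

Lemma sip_null x y : b x x <= 0 -> b x y = 0.
Proof.
move=> x0; have := sip_cauchy_schwarz x y.
have {x0}-> : b x x = 0 by apply/eqP; rewrite eq_le x0 (sip_ge0 bP).
by rewrite mul0r => h; apply/eqP; rewrite -sqrf_eq0 eq_le h sqr_ge0.
Qed.

Lemma sip_bounded D z : bounded_functional b D (b z).
Proof.
split=> [a x y|]; first by rewrite !sipE.
exists (b z z + 1); first by have := sip_ge0 bP z; lra.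
move=> x _; apply: (le_trans (sip_cauchy_schwarz z x)).
by have := sip_ge0 bP x; nra.
Qed.

Lemma bounded_functionalD D l m : bounded_functional b D l ->
  bounded_functional b D m -> bounded_functional b D (l \+ m).
Proof.
move=> [ll [M M0 lM]] [ml [N N0 mN]]; split=> [a x y /=|].
  by rewrite ll ml; ring.
exists (2 * (M + N)) => [|x Dx /=]; first lra.
have := lM _ Dx; have := mN _ Dx; have := sqr_ge0 (l x - m x).
have := sqr_ge0 (l x); have := sqr_ge0 (m x); nra.
Qed.

Section minimizer.
Context {D : set E} (subD : linear_subspace D) (Dcomplete : complete_wrt b D).
Context {I : Type} {l : I -> E -> R} (c : I -> R).
Hypothesis lP : forall i, bounded_functional b D (l i).

(* [epi p r] means that [r] is an upper bound of the supremum over [i] of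
   [l i p + c i], plus [b p p / 2]; this supremum may be infinite. *)
Let epi (p : E) (r : R) := D p /\ forall i, l i p + c i + b p p / 2 <= r.

Let l_lin i a x y : l i (a *: x + y) = a * l i x + l i y.
Proof. exact: (lP i).1. Qed.

Let epi_convex (t : R) p r p' r' : 0 <= t <= 1 -> epi p r -> epi p' r' ->
  epi (t *: (p - p') + p')
      (r' + t * (r - r') - t * (1 - t) / 2 * b (p - p') (p - p')).
Proof.
move=> /andP[t0 t1] [Dp h] [Dp' h']; split.
  by apply: subD.2 => //; exact: subspaceB.
move=> i; rewrite l_lin.
have -> : l i (p - p') = l i p - l i p'.
  by have := l_lin i (-1) p' p; rewrite scaleN1r addrC => ->; ring.
have := h i; have := h' i; rewrite !sipE (sip_sym bP p' p).
nra.
Qed.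

(** Strong convexity makes a minimising sequence Cauchy; each index contributes a continuous
    function, so the limit keeps every upper bound. Minimality along the segment from [p0] to [p]
    then yields the quadratic gap. The index [i0] bounds the infimum from below. *)
Lemma affine_sup_minimizer (i0 : I) : (exists p r, epi p r) ->
  exists p0 r0, epi p0 r0 /\
    forall p r, epi p r -> r0 + b (p - p0) (p - p0) / 2 <= r.
Proof.
move=> [p1 [r1 epi1]].
pose S := [set r | exists p, epi p r].
have S0 : S !=set0 by exists r1, p1.
have Slb : has_lbound S.
  have [_ [M M0 lM]] := lP i0; exists (c i0 - M / 2) => r [p [Dp /(_ i0) h]].
  (* Completing the square: [M * (l + b p p / 2) >= M * l + l ^+ 2 / 2 = ((l + M) ^+ 2 - M ^+ 2) /
     2], with [l] for [l i0 p]. *)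
  have h1 := lM _ Dp; have h2 := sqr_ge0 (l i0 p + M).
  suff : - (M / 2) <= l i0 p + b p p / 2 by lra.
  rewrite -(ler_pM2l M0); nra.
have hS : has_inf S by [].
pose r0 := inf S.
have r0_le p r : epi p r -> r0 <= r.
  by move=> pr; apply: ge_inf => //; exists p.
have /choice[u uP] : forall n, exists p, epi p (r0 + n.+1%:R^-1).
  move=> n; have n0 : 0 < n.+1%:R^-1 :> R by rewrite invr_gt0.
  have [r [p [Dp pr]] rlt] := inf_adherent n0 hS.
  by exists p; split=> // i; apply: le_trans (pr i) _; exact: ltW.
have half : 0 <= (2^-1 : R) <= 1 by lra.
have inv_lt (e : R) : 0 < e -> exists N, forall n, (N <= n)%N -> n.+1%:R^-1 < e.
  move=> e0; exists (Num.truncn e^-1) => n Nn.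
  rewrite invf_plt ?posrE//; apply: lt_le_trans (truncnS_gt _) _.
  by rewrite ler_nat.
(* At the midpoint, [epi_convex] and minimality give [r0 <= r0 + (x + y) / 2 - q / 8]. *)
have uC m n : b (u m - u n) (u m - u n) <= 4 * (m.+1%:R^-1 + n.+1%:R^-1).
  have := r0_le _ _ (epi_convex half (uP m) (uP n)).
  set q := b _ _; set x := m.+1%:R^-1; set y := n.+1%:R^-1.
  move=> h; lra.
have [e e0|p0 Dp0 up0] := Dcomplete (fun n => (uP n).1).
  have [N NP] := inv_lt (e / 8) ltac:(lra).
  exists N => m n Nm Nn; apply: le_lt_trans (uC m n) _.
  move: (NP _ Nm) (NP _ Nn); set x := m.+1%:R^-1; set y := n.+1%:R^-1.
  by move=> hx hy; lra.
(* From [p0] to [u n = d + p0] the value grows by [l i d + b p0 d + b d d / 2]. The last term is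
   nonnegative, and the radius [e ^+ 2 / (4 * M)] keeps the others above [- (e / 2)]. *)
have epi0 : epi p0 r0.
  split=> // i; apply/ler_addgt0Pr => e e0.
  have [ml [M M0 mM]] := bounded_functionalD (lP i) (sip_bounded D p0).
  have [N1 N1P] := inv_lt (e / 2) ltac:(lra).
  have [|N2 N2P] := up0 (e ^+ 2 / (4 * M)).
    by rewrite divr_gt0 ?exprn_gt0//; lra.
  pose n := maxn N1 N2; pose d := u n - p0.
  have {N1P}h1 := N1P n (leq_maxl _ _); have {N2P}h2 := N2P n (leq_maxr _ _).
  rewrite -/d in h2.
  have Dd : D d by apply: subspaceB => //; exact: (uP n).1.
  have md : (l i d + b p0 d) ^+ 2 <= (e / 2) ^+ 2.
    apply: (le_trans (mM _ Dd)); move: h2; rewrite ltr_pdivlMr; last lra.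
    by move=> h2; nra.
  have {}md : - (e / 2) <= l i d + b p0 d by nra.
  have := (uP n).2 i; have -> : u n = d + p0 by rewrite subrK.
  have := l_lin i 1 d p0; rewrite scale1r mul1r => ->.
  move: Dd h1 h2 md (sip_ge0 bP d); set x := n.+1%:R^-1; move: d x => d x.
  by rewrite !sipE (sip_sym bP d p0); lra.
exists p0, r0; split=> // p r pr.
apply/ler_addgt0Pr => e e0.
set B := b _ _; have B0 : 0 <= B by exact: (sip_ge0 bP).
(* Minimality on the segment, divided by [t], leaves [r - r0 >= (1 - t) / 2 * B]; this [t] ensures
   [t * B <= e]. *)
pose t := e / (B + e).
have Be : 0 < B + e by lra.
have tB : t * (B + e) = e by rewrite divfK// gt_eqF.
have t0 : 0 < t by rewrite divr_gt0.
have t1 : t <= 1 by nra.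
have := r0_le _ _ (epi_convex (t := t) ltac:(lra) pr epi0).
rewrite -/B => h.
have h2 : 0 <= t * (r - r0 - (1 - t) / 2 * B) by lra.
by move: h2; rewrite pmulr_rge0// => h2; nra.
Qed.

End minimizer.
End semi_inner_theory.

(** * Riesz representation and Minty's theorem *)

Definition sip_prod {R : realType} {E E' : lmodType R} (b : E -> E -> R)
  (b' : E' -> E' -> R) (p q : E * E') : R := b p.1 q.1 + b' p.2 q.2.

Section product.
Context {R : realType} {E E' : lmodType R}.
Context {b : E -> E -> R} {b' : E' -> E' -> R}.
Hypotheses (bP : semi_inner b) (bP' : semi_inner b').

Lemma sip_prodP : semi_inner (sip_prod b b').
Proof.
split=> [a x y z|x y|x]; rewrite /sip_prod.
- by rewrite !(sip_linear bP, sip_linear bP'); ring.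
- by rewrite (sip_sym bP) (sip_sym bP').
- by rewrite addr_ge0// ?(sip_ge0 bP) ?(sip_ge0 bP').
Qed.

Lemma subspaceX (D : set E) (D' : set E') :
  linear_subspace D -> linear_subspace D' -> linear_subspace (D `*` D').
Proof.
move=> [D0 DD] [D0' DD']; split=> [//|a u v [? ?] [? ?]].
by split; [apply: DD|apply: DD'].
Qed.

Lemma complete_wrtX (D : set E) (D' : set E') : complete_wrt b D ->
  complete_wrt b' D' -> complete_wrt (sip_prod b b') (D `*` D').
Proof.
move=> Dc Dc' u Du uC.
have [||p Dp up] := Dc (fst \o u).
- by move=> n; have [] := Du n.
- move=> e /uC[N uN]; exists N => m n Nm Nn; apply: le_lt_trans (uN _ _ Nm Nn).
  by rewrite lerDl (sip_ge0 bP').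
have [||p' Dp' up'] := Dc' (snd \o u).
- by move=> n; have [] := Du n.
- move=> e /uC[N uN]; exists N => m n Nm Nn; apply: le_lt_trans (uN _ _ Nm Nn).
  by rewrite lerDr (sip_ge0 bP).
exists (p, p') => // e e0.
have [|N NP] := up (e / 2); first lra.
have [|N' NP'] := up' (e / 2); first lra.
exists (maxn N N') => n; rewrite geq_max => /andP[/NP h /NP' h'].
by rewrite /sip_prod/=; move: h h' => /=; lra.
Qed.

End product.

Section riesz_minty.
Context {R : realType} {E : lmodType R} {b : E -> E -> R} {D : set E}.
Hypotheses (bP : semi_inner b) (subD : linear_subspace D).
Hypothesis Dcomplete : complete_wrt b D.

(** The representative minimises [b p p / 2 - l p]. In the gap inequality at [p0 + v] the term
    [b v v / 2] cancels, which leaves the first-order condition without a limit; [v] and [- v] give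
    equality. *)
Lemma riesz_representation (l : E -> R) : bounded_functional b D l ->
  exists2 p, D p & forall v, D v -> b p v = l v.
Proof.
move=> [l_lin [M M0 lM]].
have lP (i : unit) : bounded_functional b D (fun x => - l x).
  split=> [a x y|]; first by rewrite l_lin; ring.
  by exists M => // x; rewrite sqrrN; exact: lM.
have [|p0 [r0 [[Dp0 /(_ tt) h0] h]]] :=
    affine_sup_minimizer bP subD Dcomplete (c := fun=> 0) lP tt.
  by exists 0, (- l 0 + 0 + b 0 0 / 2); split=> //; exact: subD.1.
exists p0 => //.
suff ge v : D v -> 0 <= b p0 v - l v.
  move=> v Dv; have := ge _ Dv; have := ge _ (subspaceN subD Dv).
  have /= := l_lin (-1) v 0; rewrite addr0 scaleN1r.
  have := l_lin 1 0 0; rewrite scale1r addr0 (sipNr bP); lra.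
move=> Dv; have := h (p0 + v) _ (conj (subspaceD subD Dp0 Dv) (fun=> lexx _)).
have := l_lin 1 p0 v; rewrite scale1r => ->.
rewrite (addrC p0) addrK !(sipE bP) (sip_sym bP v p0); lra.
Qed.

Section minty.
Variable T : E -> E.
Hypothesis TD : forall x, D x -> D (T x).
Hypothesis T_monotone :
  forall x y, D x -> D y -> 0 <= b (T x - T y) (x - y).
Hypothesis T_hemicontinuous : forall x w, D x -> D w ->
  b (T (x + t *: w)) w @[t --> (0 : R)^'+] --> b (T x) w.

Lemma minty_maximality z y : D z ->
  (forall u, D u -> 0 <= b (T u - y) (u - z)) ->
  forall w, D w -> b (T z - y) w = 0.
Proof.
move=> Dz zy; suff ge w : D w -> 0 <= b (T z - y) w.
  move=> w Dw; have := ge _ Dw; have := ge _ (subspaceN subD Dw).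
  by rewrite (sipNr bP); lra.
move=> Dw; rewrite (sipDl bP) (sipNl bP) subr_ge0.
apply: cvgr_to_ge (T_hemicontinuous Dz Dw) _.
near=> t; have t0 : 0 < t by near: t; exact: nbhs_right_gt.
have := zy (z + t *: w) (subspaceD subD Dz (subspaceZ subD _ Dw)).
by rewrite addrAC subrr add0r (sipZr bP) pmulr_rge0// !(sipE bP) subr_ge0.
Unshelve. all: by end_near.
Qed.

(* The point is read off a minimiser of the Fitzpatrick function
   [(x, y) |-> sup_u (b x (T u) + b u y - b u (T u))] of [T], regularised by
   half the squared norm. *)
Theorem minty_surjectivity :
  exists2 x, D x & forall w, D w -> b (x + T x) w = 0.
Proof.
pose l (u : {u | D u}) p := sip_prod b b (T (sval u), sval u) p.
have bbP := sip_prodP bP bP.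
have lP u : bounded_functional (sip_prod b b) (D `*` D) (l u).
  exact: sip_bounded.
have subDD := subspaceX subD subD.
have DDc := complete_wrtX bP bP Dcomplete Dcomplete.
pose c (u : {u | D u}) := - b (sval u) (T (sval u)).
pose i0 : {u | D u} := exist _ 0 subD.1.
(* By monotonicity the Fitzpatrick function is at most [b u (T u)] at the graph point [(u, T u)]. *)
have graph u : D u -> (D `*` D) (u, T u) /\ forall i,
    l i (u, T u) + c i + sip_prod b b (u, T u) (u, T u) / 2 <=
    b u (T u) + sip_prod b b (u, T u) (u, T u) / 2.
  move=> Du; split=> [|[v Dv]]; first by split=> //; exact: TD.
  rewrite /l /c /sip_prod/=; have := T_monotone Du Dv.
  rewrite !(sipE bP) (sip_sym bP (T u)) (sip_sym bP (T v) v).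
  rewrite (sip_sym bP (T u) v).
  lra.
have [|[x0 y0] [r0 [[[/= Dx0 Dy0] h0] h]]] :=
    affine_sup_minimizer bbP subDD DDc (c := c) lP i0.
  exists (0, T 0), (b 0 (T 0) + sip_prod b b (0, T 0) (0, T 0) / 2).
  exact: graph subD.1.
(* The index [x0] gives [b (x0 + y0) (x0 + y0) / 2 <= r0]; add the gap inequality at [(u, T u)]. *)
have key u : D u -> b (x0 + y0) (x0 + y0) <= b (T u + x0) (u + y0).
  move=> Du; have := h _ _ (graph u Du); have := h0 (exist _ x0 Dx0).
  rewrite /l /c /sip_prod/= !(sipE bP).
  rewrite (sip_sym bP x0 (T _)) (sip_sym bP y0 x0) (sip_sym bP u (T u)).
  rewrite (sip_sym bP x0 u) (sip_sym bP y0 (T u)).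
  lra.
have Dz : D (- y0) by exact: subspaceN.
exists (- y0) => // w Dw.
(* By [key], [(- y0, - x0)] is monotonically related to the graph of [T], so [T (- y0)] is [- x0] up
   to a null vector. Then [key] at [- y0] makes [x0 + y0] null. *)
have max : b (T (- y0) - (- x0)) w = 0.
  apply: minty_maximality Dz _ _ Dw => u Du; rewrite !opprK.
  by apply: le_trans (key _ Du); exact: (sip_ge0 bP).
have : b (x0 + y0) w = 0.
  by apply: (sip_null bP); have := key _ Dz; rewrite addNr (sip0r bP).
by move: max; rewrite opprK !(sipE bP); lra.
Qed.

End minty.
End riesz_minty.

(** * Hilbert spaces *)

Section hilbert.
Context {R : realType} {W : hilbertType R}.

Lemma hdotP : semi_inner (hdot : W -> W -> R).
Proof.
have dotC (x y : W) : '[x, y] = '[y, x].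
  by have := hermitian_subproof (s := @hdot R W) x y; rewrite expr0 mul1r.
split=> [a x y z|x y|x]; last by rewrite hdot_normE sqr_ge0.
  by rewrite dotC linearP/= !(dotC z).
exact: dotC.
Qed.

Lemma hdot_eq0 (u : W) : '[u, u] = 0 -> u = 0.
Proof. by rewrite hdot_normE => /eqP; rewrite sqrf_eq0 normr_eq0 => /eqP. Qed.

Lemma hdot_le (u v : W) : `|'[u, v]| <= `|u| * `|v|.
Proof.
rewrite -(@ler_pXn2r _ 2)// ?nnegrE ?mulr_ge0// exprMn -!hdot_normE.
by rewrite real_normK ?num_real//; exact: (sip_cauchy_schwarz hdotP).
Qed.

Lemma hdot_continuous (u : W) : continuous (fun v : W => '[u, v] : R).
Proof.
move=> v; apply/cvgrPdist_lt => e e0; near=> w.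
rewrite -(sipNr hdotP) -(sipDr hdotP); apply: le_lt_trans (hdot_le _ _) _.
have u0 := normr_ge0 u; have : `|v - w| < e / (`|u| + 1).
  near: w; apply/nbhs_normP; exists (e / (`|u| + 1)) => //=.
  by rewrite divr_gt0//; lra.
rewrite ltr_pdivlMr ?ltr_wpDl// => h; have := normr_ge0 (v - w); nra.
Unshelve. all: by end_near. Qed.

Lemma cvg_wrt_hdot (u : nat -> W) p : cvg_wrt hdot u p -> u @ \oo --> p.
Proof.
move=> up; apply/cvgrPdist_lt => e e0; have [|N NP] := up (e ^+ 2).
  by rewrite exprn_gt0.
exists N => // n /NP; rewrite hdot_normE distrC.
by rewrite ltr_pXn2r ?nnegrE// ltW.
Qed.

Lemma hdot_complete : complete_wrt hdot [set: W].
Proof.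
move=> u _ uC.
have : cauchy (u @ \oo).
  apply: cauchy_exP => e e0; have [|N NP] := uC (e ^+ 2).
    by rewrite exprn_gt0.
  exists (u N); exists N => // n /NP /(_ (leqnn N)).
  rewrite hdot_normE distrC -ball_normE /= => h.
  by rewrite -(@ltr_pXn2r _ 2) ?nnegrE// ltW.
move=> /cauchy_cvg/cvg_ex[/= p up]; exists p => // e e0.
move/cvgrPdist_lt : up => /(_ (Num.sqrt e)) []; first by rewrite sqrtr_gt0.
move=> N _ NP; exists N => n /NP/=; rewrite hdot_normE distrC => h.
by rewrite -[e]sqr_sqrtr ?ltW// ltr_pXn2r ?nnegrE// ltW// sqrtr_gt0.
Qed.

Lemma closed_complete (S : set W) : closed S -> complete_wrt hdot S.
Proof.
move=> Sc u uS /hdot_complete[//|p _ up]; exists p => //.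
by apply: closed_cvg Sc _ _ (cvg_wrt_hdot up); exact: nearW.
Qed.

Lemma orthogonal_setP (S : set W) :
  linear_subspace (orthogonal_set S) /\ closed (orthogonal_set S).
Proof.
split.
  split=> [v _|a u v uS vS w Sw]; first exact: (sip0l hdotP).
  by rewrite (sip_linear hdotP) uS// vS// mulr0 addr0.
have -> : orthogonal_set S = \bigcap_(v in S) [set u | '[v, u] = 0].
  apply/seteqP; split=> u /= uS v Sv; first by rewrite /= (sip_sym hdotP) uS.
  by rewrite (sip_sym hdotP); exact: uS.
apply: closed_bigI => v _.
apply: (@closed_comp _ _ (fun u : W => '[v, u] : R) [set 0]).
  by move=> x _; exact: hdot_continuous.
exact: closed_eq.
Qed.

Lemma closure_normP (S : set W) x :
  closure S x <-> forall e : R, 0 < e -> exists2 y, S y & `|x - y| < e.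
Proof.
split=> [Sx e e0|Sx B /nbhs_normP[e e0 eB]].
  have [|y [Sy xy]] := Sx (ball x e); first exact: nbhsx_ballx.
  by exists y => //; rewrite -ball_normE in xy.
by have [y Sy xy] := Sx e e0; exists y; split=> //; exact: eB.
Qed.

Lemma closure_subspace (S : set W) :
  linear_subspace S -> linear_subspace (closure S).
Proof.
move=> [S0 SD]; split=> [|a u v /closure_normP Su /closure_normP Sv].
  exact: subset_closure.
apply/closure_normP => e e0; have a0 := normr_ge0 a.
have [|u' Su' uu'] := Su (e / (2 * (`|a| + 1))).
  by rewrite divr_gt0//; lra.
have [|v' Sv' vv'] := Sv (e / 2); first lra.
exists (a *: u' + v'); first exact: SD.
rewrite opprD addrACA -scalerBr; apply: le_lt_trans (ler_normD _ _) _.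
rewrite normrZ; move: uu'; rewrite ltr_pdivlMr; last lra.
by have := normr_ge0 (u - u'); nra.
Qed.

Section projection.
Context {S : set W} (subS : linear_subspace S) (Sc : closed S).

Lemma orthogonal_projP u :
  S (orthogonal_proj S u) /\ orthogonal_set S (u - orthogonal_proj S u).
Proof.
apply: (@xgetPex _ 0 [set p | S p /\ orthogonal_set S (u - p)]).
have [p Sp pP] := riesz_representation hdotP subS (closed_complete Sc)
  (sip_bounded hdotP S u).
exists p; split=> // v Sv; rewrite (sipDl hdotP) (sipNl hdotP) pP//.
exact: subrr.
Qed.

Lemma orthogonal_proj_unique u p :
  S p -> orthogonal_set S (u - p) -> orthogonal_proj S u = p.
Proof.
move=> Sp up; have [Sq uq] := orthogonal_projP u.
apply/eqP; rewrite -subr_eq0; apply/eqP/hdot_eq0.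
have Sd := subspaceB subS Sq Sp; have := up _ Sd; have := uq _ Sd.
rewrite !(sipE hdotP); lra.
Qed.

Lemma orthogonal_proj_linear a u v : orthogonal_proj S (a *: u + v) =
  a *: orthogonal_proj S u + orthogonal_proj S v.
Proof.
have [Su uu] := orthogonal_projP u; have [Sv vv] := orthogonal_projP v.
apply: orthogonal_proj_unique; first exact: subS.2.
move=> w Sw; have := uu _ Sw; have := vv _ Sw; rewrite !(sipE hdotP) => h h'.
by nra.
Qed.

Lemma orthogonal_proj_dot u v : S v -> '[orthogonal_proj S u, v] = '[u, v].
Proof.
by move=> Sv; have := (orthogonal_projP u).2 v Sv; rewrite !(sipE hdotP); lra.
Qed.

Lemma orthogonal_proj_sym u v :
  '[orthogonal_proj S u, v] = '[u, orthogonal_proj S v].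
Proof.
rewrite -(orthogonal_proj_dot u (orthogonal_projP v).1).
rewrite !(sip_sym hdotP (orthogonal_proj S u)).
by rewrite orthogonal_proj_dot//; exact: (orthogonal_projP u).1.
Qed.

Lemma orthogonal_proj_le u :
  '[orthogonal_proj S u, orthogonal_proj S u] <= '[u, u].
Proof.
have [Sp up] := orthogonal_projP u; have := up _ Sp.
have := sip_ge0 hdotP (u - orthogonal_proj S u).
rewrite !(sipE hdotP) (sip_sym hdotP u); lra.
Qed.

End projection.
End hilbert.

(** * Closed operators *)

Section operators.
Context {R : realType} {U W : hilbertType R} {T : operator U W}.

Definition graph_op : set (U * W) := [set p | op_dom T p.1 /\ T p.1 = p.2].

Lemma cvg_wrt_prod (u : nat -> U * W) p :
  cvg_wrt (sip_prod hdot hdot) u p -> u @ \oo --> p.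
Proof.
case: p => p q up.
have h1 : (u n).1 @[n --> \oo] --> p.
  apply: cvg_wrt_hdot => e /up[N NP]; exists N => n /NP; apply: le_lt_trans.
  by rewrite /sip_prod/= lerDl (sip_ge0 hdotP).
have h2 : (u n).2 @[n --> \oo] --> q.
  apply: cvg_wrt_hdot => e /up[N NP]; exists N => n /NP; apply: le_lt_trans.
  by rewrite /sip_prod/= lerDr (sip_ge0 hdotP).
have -> : u = fun n => ((u n).1, (u n).2).
  by apply/funext => n; rewrite -surjective_pairing.
exact: cvg_pair.
Qed.

Lemma closed_prod_complete (S : set (U * W)) :
  closed S -> complete_wrt (sip_prod hdot hdot) S.
Proof.
move=> Sc u uS uC.
have [//|p _ up] := complete_wrtX hdotP hdotP hdot_complete hdot_complete
  (u := u) _ uC.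
exists p => //; apply: closed_cvg Sc _ _ (cvg_wrt_prod up); exact: nearW.
Qed.

Lemma adjoint_rel_linear a w w' z z' : adjoint_rel T w z ->
  adjoint_rel T w' z' -> adjoint_rel T (a *: w + w') (a *: z + z').
Proof. by move=> h h' v Dv; rewrite !(sipE hdotP) h// h'. Qed.

Lemma adjoint_rel_closed : closed [set p : W * U | adjoint_rel T p.1 p.2].
Proof.
have -> : [set p : W * U | adjoint_rel T p.1 p.2] =
    \bigcap_(v in op_dom T) [set p : W * U | '[T v, p.1] - '[v, p.2] = 0].
  apply/seteqP; split=> p /= pT v Dv; first by rewrite /= (pT v Dv) subrr.
  by apply/eqP; rewrite -subr_eq0; apply/eqP; exact: pT.
apply: closed_bigI => v _.
pose g (p : W * U) : R := '[T v, p.1] - '[v, p.2].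
apply: (@closed_comp _ _ g [set 0]).
  move=> p _; apply: cvgB.
    apply: (@cvg_comp _ _ _ fst (fun x : W => '[T v, x] : R)).
      exact: cvg_fst.
    exact: hdot_continuous.
  apply: (@cvg_comp _ _ _ snd (fun x : U => '[v, x] : R)).
    exact: cvg_snd.
  exact: hdot_continuous.
exact: closed_eq.
Qed.

Section dense.
Hypothesis Tdense : densely_defined T.

Lemma dense_orthogonal z : orthogonal_set (op_dom T) z -> z = 0.
Proof.
move=> zT; apply: hdot_eq0; apply/eqP; rewrite eq_le (sip_ge0 hdotP) andbT.
apply/ler_addgt0Pr => e e0; rewrite add0r.
have z0 := normr_ge0 z.
have [||v [vz Dv]] := Tdense (O := ball z (e / (`|z| + 1))).
- by exists z; apply: ballxx; rewrite divr_gt0//; lra.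
- exact: ball_open.
rewrite -ball_normE /= in vz.
have -> : '[z, z] = '[z, z - v] by rewrite !(sipE hdotP) (zT v Dv) subr0.
apply: le_trans (ler_norm _) _; apply: le_trans (hdot_le _ _) _.
move: vz; rewrite ltr_pdivlMr; last lra.
by have := normr_ge0 (z - v); nra.
Qed.

Lemma adjoint_rel_uniq w z z' :
  adjoint_rel T w z -> adjoint_rel T w z' -> z = z'.
Proof.
move=> h h'; apply/eqP; rewrite -subr_eq0; apply/eqP; apply: dense_orthogonal.
move=> v Dv; rewrite (sip_sym hdotP) (sipDr hdotP) (sipNr hdotP).
by rewrite -h// -h'// subrr.
Qed.

Lemma adjointE w z : adjoint_rel T w z -> adjoint T w = z.
Proof.
move=> h; apply: xget_subset1 => // x y; exact: adjoint_rel_uniq.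
Qed.

Lemma adjointP w : op_dom (adjoint T) w -> adjoint_rel T w (adjoint T w).
Proof. by move=> [z h]; rewrite (adjointE h). Qed.

End dense.

Section closed.
Hypotheses (Tlin : linear_operator T) (Tclosed : closed_operator T).

Lemma graph_op_subspace : linear_subspace graph_op.
Proof.
have [T0 TD] := Tlin; split.
  split=> //=; have := (TD 1 0 0 T0 T0).2; rewrite scale1r addr0.
  by rewrite scale1r -{1}[T 0]addr0 => /addrI.
move=> a [u x] [v y] [/= Du <-] [/= Dv <-]; exact: TD.
Qed.

Lemma op0 : T 0 = 0. Proof. exact: graph_op_subspace.1.2. Qed.

Lemma opZ a u : op_dom T u -> T (a *: u) = a *: T u.
Proof.
move=> Du; have := (Tlin.2 a u 0 Du Tlin.1).2.
by rewrite !addr0 op0 addr0.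
Qed.

Lemma opB u v : op_dom T u -> op_dom T v -> T (u - v) = T u - T v.
Proof.
move=> Du Dv; have := (Tlin.2 (-1) v u Dv Du).2.
by rewrite !scaleN1r ![- _ + _]addrC.
Qed.

Lemma op_dom_subspace : linear_subspace (op_dom T).
Proof.
split=> [|a u v Du Dv]; first exact: Tlin.1.
exact: (Tlin.2 a u v Du Dv).1.
Qed.

Lemma im_op_subspace : linear_subspace (im_op T).
Proof.
split=> [|a x y [u Du <-] [v Dv <-]].
  by exists 0; [exact: Tlin.1|exact: op0].
by have [D E] := Tlin.2 a u v Du Dv; exists (a *: u + v).
Qed.

Lemma ker_op_subspace : linear_subspace (ker_op T).
Proof.
split=> [|a u v [Du u0] [Dv v0]]; first by split; [exact: Tlin.1|exact: op0].
by have [D E] := Tlin.2 a u v Du Dv; split=> //; rewrite E u0 v0 scaler0 addr0.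
Qed.

Lemma ker_op_closed : closed (ker_op T).
Proof.
apply: (@closed_comp _ _ (fun u : U => (u, 0 : W)) graph_op) Tclosed.
by move=> u _; apply: cvg_pair => //; exact: cvg_cst.
Qed.

(* Projecting [(x, y)] on the graph of [T] leaves a residual [(x - p, y - q)]
   with [adjoint_rel T (y - q) (p - x)], which the hypothesis forces to vanish. *)
Lemma biadjoint x y : (forall w z, adjoint_rel T w z -> '[y, w] = '[x, z]) ->
  op_dom T x /\ T x = y.
Proof.
move=> xy; have bP := sip_prodP (@hdotP R U) (@hdotP R W).
have [[p q] [/= Dp Tp] pq] := riesz_representation bP graph_op_subspace
  (closed_prod_complete Tclosed) (sip_bounded bP graph_op (x, y)).
have adj : adjoint_rel T (y - q) (p - x).
  move=> v Dv; have := pq (v, T v) (conj Dv erefl); rewrite /sip_prod/=.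
  rewrite (sip_sym hdotP (T v)) (sip_sym hdotP v) !(sipE hdotP); lra.
(* Subtracting [h'] from [h] gives ['[y - q, y - q] = - '[x - p, x - p]]. *)
have h := xy _ _ adj; have h' := adj p Dp; rewrite Tp in h'.
have hx := sip_ge0 hdotP (x - p); have hy := sip_ge0 hdotP (y - q).
have s : '[x - p, x - p] + '[y - q, y - q] = 0.
  move: h h'; rewrite !(sipE hdotP); rewrite (sip_sym hdotP p x).
  by rewrite (sip_sym hdotP q y); lra.
have /hdot_eq0/subr0_eq-> : '[x - p, x - p] = 0 by lra.
by have /hdot_eq0/subr0_eq-> : '[y - q, y - q] = 0 by lra.
Qed.

(** * Closed range: lower bounds for an operator and its adjoint *)

Section closed_range.
Hypothesis Tim : closed (im_op T).

(* Banach-Steinhaus for the functionals [y |-> '[P y, w]], where [P] projects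
   on the range and [w] has an adjoint value of norm at most 1: at [T u] they
   are bounded by [`|u|]. *)
Lemma closed_range_bound : exists2 M : R, 0 < M &
  forall u w z, op_dom T u -> adjoint_rel T w z ->
    `|'[T u, w]| <= M * `|T u| * `|z|.
Proof.
pose P := orthogonal_proj (im_op T).
pose F := [set f : W -> R^o | exists w z,
  [/\ adjoint_rel T w z, `|z| <= 1 & f = fun y => '[P y, w] : R]].
have PP := orthogonal_projP im_op_subspace Tim.
have PE u : op_dom T u -> P (T u) = T u.
  move=> Du; apply: orthogonal_proj_unique => //.
  - exact: im_op_subspace.
  - by exists u.
  - by rewrite subrr => v _; exact: (sip0l hdotP).
have Ple y : `|P y| <= `|y|.
  rewrite -(@ler_pXn2r _ 2)// ?nnegrE// -!hdot_normE.
  exact: orthogonal_proj_le im_op_subspace Tim _.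
have [||M MP] := @Banach_Steinhauss R W R^o F _ _ 1.
- move=> _ [w [z [wz z1 ->]]]; split.
    move=> r; exists (r * `|w|) => x xr; apply: le_trans (hdot_le _ _) _.
    by apply: ler_wpM2r => //; apply: le_trans (Ple _) xr.
  move=> a x y; rewrite /P orthogonal_proj_linear//; last exact: im_op_subspace.
  exact: (sip_linear hdotP).
- move=> y; have [u Du Tu] := (PP y).1; exists `|u|.
  move=> _ [w [z [wz z1 ->]]]; rewrite -/P in Tu; rewrite -Tu wz//.
  by apply: le_trans (hdot_le _ _) _; apply: ler_piMr.
have M1 : 0 < `|M| + 1 by have := normr_ge0 M; lra.
exists (`|M| + 1) => // u w z Du wz.
have [Tu0|Tu0] := eqVneq `|T u| 0.
  by apply: le_trans (hdot_le _ _) _; rewrite Tu0 mulr0 !mul0r.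
have [z0|z0] := eqVneq `|z| 0.
  by rewrite wz//; apply: le_trans (hdot_le _ _) _; rewrite z0 !mulr0.
have {}Tu0 : 0 < `|T u| by rewrite lt_def Tu0 normr_ge0.
have {}z0 : 0 < `|z| by rewrite lt_def z0 normr_ge0.
have norm1 (V : normedModType R) (v : V) : 0 < `|v| -> `| `|v|^-1 *: v| <= 1.
  by move=> v0; rewrite normrZ gtr0_norm ?invr_gt0// mulVf// gt_eqF.
(* The uniform bound concerns unit vectors: [T u] and the pair [(w, z)] are rescaled by the norms of
   [T u] and [z]. *)
have := MP (fun y => '[P y, `|z|^-1 *: w]) _ (`|T u|^-1 *: T u) (norm1 _ _ Tu0).
rewrite -opZ// PE; last by apply: subspaceZ => //; exact: op_dom_subspace.
rewrite opZ// !(sipE hdotP) !normrM !normfV !normr_id => h.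
have {}h : `|T u|^-1 * (`|z|^-1 * `|'[T u, w]|) <= M.
  apply: h; exists (`|z|^-1 *: w), (`|z|^-1 *: z); split=> //;
    last exact: norm1.
  rewrite -[_ *: w]addr0 -[_ *: z]addr0; apply: adjoint_rel_linear => // v _.
  by rewrite !(sip0r hdotP).
move: h; rewrite mulrA -invfM ler_pdivrMl ?mulr_gt0// => h.
apply: (le_trans h); rewrite mulrC mulrA ler_wpM2r// ler_wpM2r//.
by have := ler_norm M; lra.
Qed.

Lemma adjoint_bounded_below : exists2 M : R, 0 < M &
  forall w z, im_op T w -> adjoint_rel T w z -> '[w, w] <= M * '[z, z].
Proof.
have [M M0 MP] := closed_range_bound; exists (M ^+ 2); first exact: exprn_gt0.
move=> _ z [u Du <-] wz; have := MP _ _ _ Du wz.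
rewrite !hdot_normE normrX normr_id -exprMn => h.
rewrite ler_pXn2r ?nnegrE// ?mulr_ge0//; last exact: ltW.
have [->|] := eqVneq `|T u| 0; first by rewrite mulr_ge0// ltW.
rewrite -normr_gt0 normr_id => Tu0.
by rewrite -(ler_pM2l Tu0) -expr2 mulrA (mulrC _ M).
Qed.

(** A vector orthogonal to the kernel is a limit of adjoint values: its residual after projection on
    their closure lies in the kernel by [biadjoint]. For an adjoint value [z] of [w], ['[u, z] =
    '[T u, w]] is controlled by [closed_range_bound]. *)
Lemma op_bounded_below : exists2 M : R, 0 < M & forall u,
  op_dom T u -> orthogonal_set (ker_op T) u -> '[u, u] <= M * '[T u, T u].
Proof.
have [M M0 MP] := closed_range_bound; exists (M ^+ 2); first exact: exprn_gt0.
move=> u Du uker.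
pose S := [set z | exists w, adjoint_rel T w z].
have subS : linear_subspace S.
  split=> [|a z z' [w wz] [w' wz']].
    by exists 0 => v _; rewrite !(sip0r hdotP).
  by exists (a *: w + w'); exact: adjoint_rel_linear.
have [Pu uP] :=
  orthogonal_projP (closure_subspace subS) (@closed_closure _ S) u.
set p := orthogonal_proj _ u in Pu uP.
have up : u = p.
  apply/eqP; rewrite -subr_eq0; apply/eqP/hdot_eq0.
  have kerup : ker_op T (u - p).
    apply: biadjoint => w z wz; rewrite (sip0l hdotP) uP//.
    by apply: subset_closure; exists w.
  have := uker _ kerup; have := uP _ Pu; rewrite !(sipE hdotP).
  rewrite (sip_sym hdotP p u); lra.
rewrite -up in Pu; rewrite !hdot_normE -exprMn.
have MT : 0 <= M * `|T u| by rewrite mulr_ge0// ltW.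
rewrite ler_pXn2r ?nnegrE//.
suff : `|u| ^+ 2 <= M * `|T u| * `|u|.
  have [->//|u0] := eqVneq `|u| 0.
  by rewrite expr2 ler_pM2r// lt_def u0 normr_ge0.
apply/ler_addgt0Pr => e e0; have u0 := normr_ge0 u.
(* Replacing [u] by [z] costs at most [|u - z|] times the sum of [|u|] and [M * |T u|], hence less
   than [e]. *)
pose c := `|u| + M * `|T u| + 1; have c0 : 0 < c by rewrite /c; lra.
have /closure_normP/(_ (e / c))[|z [w wz] uz] := Pu; first exact: divr_gt0.
have h1 := le_trans (ler_norm _) (MP _ _ _ Du wz); rewrite wz// in h1.
have h2 := le_trans (ler_norm _) (hdot_le u (u - z)).
have h3 : `|z| <= `|u| + `|u - z|.
  by rewrite -{1}(subKr u z); exact: ler_normB.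
have h4 : `|u| ^+ 2 = '[u, u - z] + '[u, z].
  by rewrite -hdot_normE -(sipDr hdotP) subrK.
move: uz; rewrite ltr_pdivlMr// => uz; rewrite h4.
have := ler_wpM2l MT h3; have := normr_ge0 (u - z); rewrite /c in uz; nra.
Qed.

End closed_range.
End closed.
End operators.

(** * Hodge theory *)

Local Arguments adjoint : simpl never.

Section complex.
Context {R : realType} {C : hilbertComplex R} (C_closed : closed_complex C).
Context {k : int}.

Let din_lin : linear_operator (d_in C k) := @cdiff_linear R C _ _ (subrK 1 k).
Let din_closed : closed_operator (d_in C k) :=
  @cdiff_closed R C _ _ (subrK 1 k).
Let din_dense : densely_defined (d_in C k) := @cdiff_dense R C _ _ (subrK 1 k).
Let din_im : closed (im_op (d_in C k)) := @C_closed _ _ (subrK 1 k).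
Let dout_lin : linear_operator (d_out C k) :=
  @cdiff_linear R C _ _ (erefl (k + 1)).
Let dout_closed : closed_operator (d_out C k) :=
  @cdiff_closed R C _ _ (erefl (k + 1)).
Let dout_dense : densely_defined (d_out C k) :=
  @cdiff_dense R C _ _ (erefl (k + 1)).
Let dout_im : closed (im_op (d_out C k)) := @C_closed _ _ (erefl (k + 1)).

Let PZ := orthogonal_proj (cocycles C k).
Let PB := orthogonal_proj (coboundaries C k).
Let PH := P_harmonic C k.

Let subZ : linear_subspace (cocycles C k) := ker_op_subspace dout_lin.
Let subB : linear_subspace (coboundaries C k) := im_op_subspace din_lin.
Let PZP := orthogonal_projP subZ (ker_op_closed dout_closed).
Let PBP := orthogonal_projP subB din_im.

(** * Hodge decomposition in degree [k] *)

Lemma coboundaries_cocycles : coboundaries C k `<=` cocycles C k.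
Proof. by move=> _ [u Du <-]; exact: cdiff_comp. Qed.

Lemma harmonic_subspace : linear_subspace (Defs.harmonic C k).
Proof.
have [[h0 hD] _] := orthogonal_setP (coboundaries C k).
split; first by split; [exact: subZ.1|].
by move=> a u v [Zu uB] [Zv vB]; split; [exact: subZ.2|exact: hD].
Qed.

Lemma harmonic_closed : closed (Defs.harmonic C k).
Proof.
apply: closedI; first exact: ker_op_closed.
exact: (orthogonal_setP _).2.
Qed.

Let PHP := orthogonal_projP harmonic_subspace harmonic_closed.

(** The cocycles are the orthogonal sum of the coboundaries and the harmonic space. *)
Lemma P_harmonicE u : PH u = PZ u - PB u.
Proof.
apply: orthogonal_proj_unique; rewrite -/PZ.
- exact: harmonic_subspace.
- exact: harmonic_closed.
- split.
    exact: (subspaceB subZ (PZP u).1 (coboundaries_cocycles (PBP u).1)).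
  move=> v Bv; have := (PZP u).2 v (coboundaries_cocycles Bv).
  by have := (PBP u).2 v Bv; rewrite -/PZ -/PB !(sipE hdotP); lra.
- move=> h [Zh hB]; have := (PZP u).2 h Zh; have := hB _ (PBP u).1.
  rewrite -/PZ -/PB (sip_sym hdotP h) !(sipE hdotP); lra.
Qed.

Lemma P_harmonic_linear (a : R) u v : PH (a *: u + v) = a *: PH u + PH v.
Proof.
exact: orthogonal_proj_linear harmonic_subspace harmonic_closed _ _ _.
Qed.

Lemma P_harmonic0 u : orthogonal_set (Defs.harmonic C k) u -> PH u = 0.
Proof.
move=> uH; apply: orthogonal_proj_unique.
- exact: harmonic_subspace.
- exact: harmonic_closed.
- exact: harmonic_subspace.1.
- by rewrite subr0.
Qed.

Lemma adjoint_rel_coboundaries u :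
  orthogonal_set (coboundaries C k) u -> adjoint_rel (d_in C k) u 0.
Proof.
move=> uB v Dv; rewrite (sip0r hdotP) (sip_sym hdotP); apply: uB.
by exists v.
Qed.

(** Being orthogonal to all cocycles, [v - PZ v] is a test vector for which only the [d] term of the
    inner product survives. *)
Lemma coexact_part v : dom_V C k v ->
  [/\ dom_V C k (v - PZ v), d_out C k (v - PZ v) = d_out C k v,
      adjoint_rel (d_in C k) (v - PZ v) 0 & PH (v - PZ v) = 0].
Proof.
move=> Dv; have [[DZ Z0] vZ] := PZP v; split.
- exact: (subspaceB (op_dom_subspace dout_lin)).
- by rewrite opB// Z0 subr0.
- by apply: adjoint_rel_coboundaries => w /coboundaries_cocycles; exact: vZ.
- by apply: P_harmonic0 => w [Zw _]; exact: vZ.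
Qed.

(** Dually, [PB w] isolates the [d^*] term: it differs from [w] by a vector orthogonal to the
    coboundaries, whose adjoint value is 0. *)
Lemma exact_part w z : adjoint_rel (d_in C k) w z ->
  [/\ dom_V C k (PB w), d_out C k (PB w) = 0,
      adjoint_rel (d_in C k) (PB w) z & PH (PB w) = 0].
Proof.
move=> wz; have [Bw wB] := PBP w; have [DB B0] := coboundaries_cocycles Bw.
split=> //.
- have := adjoint_rel_linear (-1) (adjoint_rel_coboundaries wB) wz.
  by rewrite scaler0 add0r scaleN1r opprB subrK.
- by apply: P_harmonic0 => h [_ hB]; rewrite (sip_sym hdotP); exact: hB.
Qed.

(* [V^k `&` V^*_k], with its inner product, encoded as the set of the triples
   [(u, d^* u, d u)]. *)
Definition hodge_graph : set (C k * C (k - 1) * C (k + 1)) :=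
  [set p | [/\ adjoint_rel (d_in C k) p.1.1 p.1.2, dom_V C k p.1.1
             & d_out C k p.1.1 = p.2]].

(** The first component counts only through its harmonic part, so the form may degenerate on the
    whole product; [poincare] makes it definite on [hodge_graph]. *)
Definition hodge_form : C k * C (k - 1) * C (k + 1) ->
    C k * C (k - 1) * C (k + 1) -> R :=
  sip_prod (sip_prod (fun u v => '[PH u, PH v]) hdot) hdot.

Local Notation D := hodge_graph.
Local Notation b := hodge_form.

Lemma hodge_formP : semi_inner b.
Proof.
do 2?apply: sip_prodP; try exact: hdotP.
split=> [a x y z|x y|x]; last exact: (sip_ge0 hdotP).
  by rewrite P_harmonic_linear (sip_linear hdotP).
exact: (sip_sym hdotP).
Qed.

Lemma hodge_graph_subspace : linear_subspace D.
Proof.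
split.
  split=> /=; [|exact: dout_lin.1|exact: op0].
  by move=> v _; rewrite !(sip0r hdotP).
move=> a p q [p1 p2 p3] [q1 q2 q3]; have [DD E] := dout_lin.2 a _ _ p2 q2.
split=> //=; first exact: adjoint_rel_linear.
by rewrite E p3 q3.
Qed.

(** Split [u] as [PB u + PH u + (u - PZ u)]. The adjoint is bounded below on the first part, [d] on
    the last, and the middle one occurs in [b]. *)
Lemma poincare : exists2 M : R, 1 <= M &
  forall p, D p -> '[p.1.1, p.1.1] <= M * b p p.
Proof.
have [M1 M10 M1P] := adjoint_bounded_below din_lin din_im.
have [M2 M20 M2P] := op_bounded_below dout_lin dout_closed dout_im.
exists (3 * (M1 + M2 + 1)); first lra.
move=> [[u a] c] [/= ua Du duc].
have [DB _ aB _] := exact_part ua; have h1 := M1P _ _ (PBP u).1 aB.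
have [DZ dZ _ _] := coexact_part Du; have h2 := M2P _ DZ (PZP u).2.
rewrite dZ duc in h2.
have := sip_sum3_le hdotP (PB u) (PH u) (u - PZ u).
have -> : PB u + PH u + (u - PZ u) = u.
  by rewrite P_harmonicE [PB u + _]addrC subrK addrC subrK.
have := sip_ge0 hdotP a; have := sip_ge0 hdotP c.
have := sip_ge0 hdotP (PH u); rewrite /b /sip_prod/=; nra.
Qed.

(** By [poincare] the full product norm squared is at most [(M + 1) * b], so a limit exists in the
    product. Closedness of [d] and of the adjoint relation keeps it in [D], and [PH] is a
    contraction. *)
Lemma hodge_graph_complete : complete_wrt b D.
Proof.
have [M M1 MP] := poincare.
have fullP := sip_prodP (sip_prodP (@hdotP R (C k)) (@hdotP R (C (k - 1))))
  (@hdotP R (C (k + 1))).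
have fullc := complete_wrtX (sip_prodP hdotP hdotP) hdotP
  (complete_wrtX hdotP hdotP (@hdot_complete R (C k))
    (@hdot_complete R (C (k - 1))))
  (@hdot_complete R (C (k + 1))).
move=> u Du uC.
have [//||[[x a] c] _ up] := fullc u.
  move=> e e0; have [|N NP] := uC (e / (M + 1)).
    by rewrite divr_gt0//; lra.
  exists N => m n Nm Nn; have := NP _ _ Nm Nn.
  have := MP _ (subspaceB hodge_graph_subspace (Du m) (Du n)).
  rewrite ltr_pdivlMr; last lra.
  have := sip_ge0 hdotP (PH (u m - u n).1.1).
  rewrite /b /sip_prod/=; lra.
have up1 : cvg_wrt (sip_prod hdot hdot) (fst \o u) (x, a).
  move=> e /up[N NP]; exists N => n /NP; apply: le_lt_trans.
  by rewrite [leRHS]/sip_prod lerDl (sip_ge0 hdotP).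
have up2 : cvg_wrt (sip_prod hdot hdot) (fun n => ((u n).1.1, (u n).2)) (x, c).
  move=> e /up[N NP]; exists N => n /NP; apply: le_lt_trans.
  rewrite /sip_prod/= lerD2r lerDl; exact: (sip_ge0 hdotP).
exists ((x, a), c).
  have := closed_cvg _ (@adjoint_rel_closed _ _ _ (d_in C k)) _ _
    (cvg_wrt_prod up1).
  have := closed_cvg _ dout_closed _ _ (cvg_wrt_prod up2).
  move=> [|Dx dx]; first by apply: nearW => n; have [] := Du n.
  by move=> xa; split=> //; apply: xa; apply: nearW => n; have [] := Du n.
move=> e /up[N NP]; exists N => n /NP; apply: le_lt_trans.
rewrite /b /sip_prod/= !lerD2r.
exact: orthogonal_proj_le harmonic_subspace harmonic_closed _.
Qed.

Definition hodge_lift (u : C k) : C k * C (k - 1) * C (k + 1) :=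
  ((u, dstar_out C k u), d_out C k u).

Lemma hodge_graph_lift u :
  dom_V C k u -> dom_Vstar C k u -> D (hodge_lift u).
Proof. by move=> Du Dsu; split=> //=; exact: adjointP. Qed.

Lemma hodge_graph_liftE p : D p -> p = hodge_lift p.1.1.
Proof.
case: p => [[u a] c] [/= ua Du <-]; congr (_, _, _).
exact/esym/(adjointE din_dense ua).
Qed.

Lemma norm_VVstarE u :
  norm_VVstar C k u = Num.sqrt (b (hodge_lift u) (hodge_lift u)).
Proof.
by congr Num.sqrt; rewrite /dot_VVstar /b /sip_prod/= -/PH addrC addrA.
Qed.

(* Testing with [v - PZ v] puts [d u] in the domain of [d^*]; testing with
   [PB w] puts [d^* u] in that of [d^**] = [d]. *)
Lemma weak_solution p g : D p -> (forall v, D v -> b p v = '[g, v.1.1]) ->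
  D_L C k p.1.1 /\ bold_L C k p.1.1 = g.
Proof.
case: p => [[u a] c] Dp pg; have [/= ua Du duc] := Dp.
have c_adj : adjoint_rel (d_out C k) c (g - PZ g).
  move=> v Dv; have [DZ dZ aZ HZ] := coexact_part Dv.
  have := pg ((v - PZ v, 0), d_out C k v) (And3 aZ DZ dZ).
  rewrite /b /sip_prod/= HZ !(sip0r hdotP) !add0r (sip_sym hdotP c) => ->.
  rewrite (sip_sym hdotP v) !(sipE hdotP); congr (_ - _).
  by rewrite (orthogonal_proj_sym subZ (ker_op_closed dout_closed)).
have [Da da] : op_dom (d_in C k) a /\ d_in C k a = PB g.
  apply: biadjoint => // w z wz; have [DB dB aB HB] := exact_part wz.
  have := pg ((PB w, z), 0) (And3 aB DB dB).
  rewrite /b /sip_prod/= HB !(sip0r hdotP) add0r addr0 => ->.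
  exact: (orthogonal_proj_sym subB din_im).
(* Test with the harmonic vector [PH u - PH g], for which the other two terms vanish. *)
have Hu : PH u = PH g.
  have subH := harmonic_subspace; have closedH := harmonic_closed.
  apply/eqP; rewrite -subr_eq0; apply/eqP/hdot_eq0.
  have Hh : Defs.harmonic C k (PH u - PH g).
    exact: (subspaceB subH (PHP u).1 (PHP g).1).
  set h := PH u - PH g in Hh *.
  have [[Dh dh] hB] := Hh.
  have hE : PH h = h.
    apply: orthogonal_proj_unique => //; rewrite subrr => v _.
    exact: (sip0l hdotP).
  have := pg ((h, 0), 0) (And3 (adjoint_rel_coboundaries hB) Dh dh).
  rewrite /b /sip_prod/= hE !(sip0r hdotP) !addr0.
  rewrite -(orthogonal_proj_dot subH closedH g Hh) -/(P_harmonic C k g).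
  rewrite -/PH => e.
  by rewrite {1}/h (sipDl hdotP) (sipNl hdotP) e subrr.
have ds : dstar_out C k u = a by exact: adjointE.
have dsi : dstar_in C k (d_out C k u) = g - PZ g.
  by apply: adjointE; rewrite ?duc.
suff : D_L C k u /\ bold_L C k u = g by [].
split.
  by split; [|exists a|exists (g - PZ g); rewrite duc|rewrite ds].
have -> : bold_L C k u =
    d_in C k (dstar_out C k u) + dstar_in C k (d_out C k u) + PH u by [].
by rewrite ds dsi da Hu P_harmonicE addrC addrA subrK addrC subrK.
Qed.

Lemma bold_L_weak u v : D_L C k u -> D v ->
  b (hodge_lift u) v = '[bold_L C k u, v.1.1].
Proof.
have -> : bold_L C k u =
    d_in C k (dstar_out C k u) + dstar_in C k (d_out C k u) + PH u by [].
move=> [Du Dsu Ddu Dsdu]; case: v => [[v a] c] [/= va Dv <-].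
rewrite !(sipDl hdotP) (va _ Dsdu) (sip_sym hdotP (dstar_in C k _)).
rewrite -(adjointP dout_dense Ddu Dv) (sip_sym hdotP (d_out C k v)).
have -> : '[PH u, v] = '[PH u, PH v].
  rewrite !(sip_sym hdotP (PH u)); apply/esym.
  exact: (orthogonal_proj_dot harmonic_subspace harmonic_closed v (PHP u).1).
by rewrite [RHS]addrC addrA.
Qed.

Lemma bold_K_spec g : D_L C k (bold_K C k g) /\ bold_L C k (bold_K C k g) = g.
Proof.
have [M M1 MP] := poincare.
have gb : bounded_functional b D (fun p => '[g, p.1.1]).
  split=> [a p q|]; first by rewrite /= !(sipE hdotP).
  have g0 := sip_ge0 hdotP g.
  exists (('[g, g] + 1) * M) => [|p Dp]; first by apply: mulr_gt0; lra.
  apply: (le_trans (sip_cauchy_schwarz hdotP _ _)).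
  by have := MP _ Dp; have := sip_ge0 hdotP p.1.1; rewrite -mulrA; nra.
have [p Dp pg] := riesz_representation hodge_formP hodge_graph_subspace
  hodge_graph_complete gb.
have [DL Lg] := weak_solution Dp pg.
by apply: (@xgetPex _ 0 [set u | D_L C k u /\ bold_L C k u = g]); exists p.1.1.
Qed.

Lemma hodge_graph_D_L u : D_L C k u -> D (hodge_lift u).
Proof. by move=> [Du Dsu _ _]; exact: hodge_graph_lift. Qed.

Lemma bold_K_weak g v : D v -> b (hodge_lift (bold_K C k g)) v = '[g, v.1.1].
Proof.
by have [DL Lg] := bold_K_spec g; move=> /(bold_L_weak DL) ->; rewrite Lg.
Qed.

Lemma norm_VVstar_sqr u :
  norm_VVstar C k u ^+ 2 = b (hodge_lift u) (hodge_lift u).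
Proof. by rewrite norm_VVstarE sqr_sqrtr//; exact: (sip_ge0 hodge_formP). Qed.

(** This bounds the set in [opnorm_K], so its [sup] is a genuine supremum. With [q] the squared norm
    of [K g], [q = '[g, K g]]; Cauchy-Schwarz and [poincare] give [q * q <= '[g, g] * (M * q)]. *)
Lemma norm_bold_K_le : exists M : R,
  forall g, norm_VVstar C k (bold_K C k g) <= M * `|g|.
Proof.
have [M M1 MP] := poincare; exists M => g.
have DK := hodge_graph_D_L (bold_K_spec g).1.
have q0 := sip_ge0 hodge_formP (hodge_lift (bold_K C k g)).
have M0 : 0 <= M by lra.
rewrite -(@ler_pXn2r _ 2)// ?nnegrE ?sqrtr_ge0 ?mulr_ge0//.
rewrite norm_VVstar_sqr exprMn -hdot_normE.
have h := MP _ DK.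
have := sip_cauchy_schwarz hdotP g (bold_K C k g).
rewrite -[X in X ^+ 2](bold_K_weak g DK) /= in h * => h'.
have g0 := sip_ge0 hdotP g; have h2 := ler_wpM2l g0 h.
move: q0 h2 h'; set q := b _ _; set x := '[g, g] in g0 *.
move: ('[_, _]) => y q0 h2 h'.
have [->|q_neq] := eqVneq q 0; first by rewrite mulr_ge0// exprn_ge0.
have {}q0 : 0 < q by rewrite lt_def q_neq.
have : q * q <= q * (M * x) by nra.
rewrite ler_pM2l// => h3; apply: (le_trans h3).
by rewrite ler_wpM2r// expr2 ler_peMl.
Qed.

(** Homogeneity is read off the weak formulation: by symmetry of [b], the scalar [a] is extracted
    once from each argument. *)
Lemma norm_bold_KZ a g :
  norm_VVstar C k (bold_K C k (a *: g)) = `|a| * norm_VVstar C k (bold_K C k g).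
Proof.
have D1 := hodge_graph_D_L (bold_K_spec (a *: g)).1.
have D2 := hodge_graph_D_L (bold_K_spec g).1.
apply/eqP; rewrite -(@eqrXn2 _ 2) ?sqrtr_ge0 ?mulr_ge0 ?sqrtr_ge0//.
rewrite exprMn !norm_VVstar_sqr real_normK ?num_real// expr2.
rewrite (bold_K_weak (a *: g) D1) (sipZl hdotP) -mulrA -(bold_K_weak g D1).
rewrite (sip_sym hodge_formP) (bold_K_weak (a *: g) D2) (sipZl hdotP).
by rewrite -(bold_K_weak g D2).
Qed.

Lemma norm_bold_K_opnorm g :
  norm_VVstar C k (bold_K C k g) <= opnorm_K C k * `|g|.
Proof.
have [g0|g0] := eqVneq `|g| 0.
  have [M MP] := norm_bold_K_le.
  by have := MP g; rewrite g0 !mulr0.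
have {}g0 : 0 < `|g| by rewrite lt_def g0 normr_ge0.
rewrite -ler_pdivrMr// mulrC -[X in X * _]gtr0_norm ?invr_gt0//.
rewrite -norm_bold_KZ; apply: ub_le_sup.
  have [M MP] := norm_bold_K_le; exists `|M| => _ [f /= f1 <-].
  apply: le_trans (MP f) _; have := ler_norm M; have := normr_ge0 f.
  have := normr_ge0 M; nra.
exists (`|g|^-1 *: g) => //=.
by rewrite normrZ gtr0_norm ?invr_gt0// mulVf// gt_eqF.
Qed.

(** * The semilinear equation *)

Section semilinear.
Variable F : C k -> C k.
Hypothesis F_monotone : monotone_on (dom_V C k) F.

Lemma semilinear_lipschitz f f' u u' :
  D_L C k u -> bold_L C k u + F u = f ->
  D_L C k u' -> bold_L C k u' + F u' = f' ->
  norm_VVstar C k (u - u') <= opnorm_K C k * `|f - f'|.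
Proof.
move=> Du uf Du' uf'.
apply: le_trans (norm_bold_K_opnorm (f - f')).
set K := bold_K C k (f - f').
have De := subspaceB hodge_graph_subspace (hodge_graph_D_L Du)
  (hodge_graph_D_L Du').
have eE := hodge_graph_liftE De.
rewrite -(@ler_pXn2r _ 2)// ?nnegrE ?sqrtr_ge0//.
(* As [hodge_graph] is a subspace, the difference of the two lifts is the lift of [u - u']. *)
rewrite !norm_VVstar_sqr -[u - u']/((hodge_lift u - hodge_lift u').1.1) -eE.
set e := hodge_lift u - hodge_lift u' in De eE *.
have h1 : b e e = '[bold_L C k u - bold_L C k u', u - u'].
  by rewrite {1}/e (sipBl hodge_formP) !bold_L_weak// -(sipBl hdotP).
have h2 : b (hodge_lift K) e = '[f - f', u - u'] by exact: bold_K_weak.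
have h3 : 0 <= '[F u - F u', u - u'].
  by apply: F_monotone; [case: Du|case: Du'].
have h4 : b e e <= b (hodge_lift K) e.
  rewrite h1 h2 -subr_ge0 -(sipBl hdotP) -uf -uf'.
  suff -> (x y z t : C k) : x + y - (z + t) - (x - z) = y - t by [].
  by rewrite (opprD z t) (addrACA x y) [LHS]addrC addKr.
have h5 := sip_cauchy_schwarz hodge_formP (hodge_lift K) e.
have e0 := sip_ge0 hodge_formP e.
have k0 := sip_ge0 hodge_formP (hodge_lift K).
(* By [h4] and [h5], [b e e ^+ 2] is at most the squared norm of [K] times [b e e]; the factor
   [b e e] is cancelled. *)
have [->//|e_neq] := eqVneq (b e e) 0.
have {}e0 : 0 < b e e by rewrite lt_def e_neq.
rewrite -(ler_pM2r e0); apply: le_trans h5; rewrite expr2.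
by apply: ler_pM => //; exact: ltW.
Qed.

Lemma semilinear_unique f u u' :
  D_L C k u -> bold_L C k u + F u = f ->
  D_L C k u' -> bold_L C k u' + F u' = f -> u = u'.
Proof.
move=> Du uf Du' uf'; apply/eqP; rewrite -subr_eq0; apply/eqP/hdot_eq0.
have := semilinear_lipschitz Du uf Du' uf'; rewrite subrr normr0 mulr0 => h.
have De := subspaceB hodge_graph_subspace (hodge_graph_D_L Du)
  (hodge_graph_D_L Du').
have [M M1 MP] := poincare.
have := MP _ De; rewrite [in X in _ * X](hodge_graph_liftE De).
have := norm_VVstar_sqr (u - u').
have -> : norm_VVstar C k (u - u') = 0 by apply/eqP; rewrite eq_le h sqrtr_ge0.
rewrite expr0n /= => <-; rewrite mulr0 => h'.
by apply/eqP; rewrite eq_le h' (sip_ge0 hdotP).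
Qed.

Hypothesis F_hemicontinuous : hemicontinuous_on (dom_V C k) F.

Lemma semilinear_exists f :
  exists u, D_L C k u /\ bold_L C k u + F u = f.
Proof.
pose T (p : C k * C (k - 1) * C (k + 1)) :=
  hodge_lift (bold_K C k (F p.1.1 - f)).
have TE p v : D v -> b (T p) v = '[F p.1.1 - f, v.1.1] by exact: bold_K_weak.
have subD := hodge_graph_subspace.
have [|||x Dx xT] := minty_surjectivity hodge_formP subD hodge_graph_complete
    (T := T).
- by move=> x _; exact: hodge_graph_D_L (bold_K_spec _).1.
- move=> x y Dx Dy; have Dxy := subspaceB subD Dx Dy.
  rewrite (sipBl hodge_formP) !TE// -(sipBl hdotP) opprB addrA subrK.
  by apply: F_monotone; [case: Dx|case: Dy].
- move=> x w Dx Dw; rewrite TE//.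
  have -> : (fun t : R => b (T (x + t *: w)) w) =
      (fun t => '[F (x.1.1 + t *: w.1.1), w.1.1] - '[f, w.1.1]).
    by apply/funext => t; rewrite TE// (sipBl hdotP).
  rewrite (sipBl hdotP); apply: cvgB; last exact: cvg_cst.
  have [_ Dx2 _] := Dx; have [_ Dw2 _] := Dw.
  (* Continuity within [[0, 1]] contains the right limit at 0 that Minty's theorem asks for. *)
  have [_ + _] := (continuous_within_itvP _ ltr01).1
    (F_hemicontinuous (w := w.1.1) Dx2 Dw2).
  by rewrite scale0r addr0.
(* [xT] says that [x] solves the linear problem weakly with right-hand side [f - F x.1.1]. *)
have [Du Lu] : D_L C k x.1.1 /\ bold_L C k x.1.1 = f - F x.1.1.
  apply: weak_solution => // v Dv; have := xT v Dv.
  rewrite (sipDl hodge_formP) TE// -(opprB (F x.1.1)) (sipNl hdotP); lra.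
by exists x.1.1; split=> //; rewrite Lu subrK.
Qed.

End semilinear.
End complex.

Unset Implicit Arguments.

Theorem theorem3p3 (R : realType) (C : hilbertComplex R)
    (C_closed : closed_complex C) (k : int) (F : C k -> C k)
    (F_monotone : monotone_on (dom_V C k) F)
    (F_hemicontinuous : hemicontinuous_on (dom_V C k) F) :
  (forall f : C k, exists! u : C k, D_L C k u /\ bold_L C k u + F u = f) /\
  (forall f f' u u' : C k,
      D_L C k u -> bold_L C k u + F u = f ->
      D_L C k u' -> bold_L C k u' + F u' = f' ->
      norm_VVstar C k (u - u') <= opnorm_K C k * `|f - f'|).
Proof.
split=> [f|f f' u u']; last exact: semilinear_lipschitz.
have [u [Du uf]] := semilinear_exists C_closed F_monotone F_hemicontinuous f.
exists u; split=> // u' [Du' uf'].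
exact: (semilinear_unique C_closed F_monotone Du uf Du' uf').
Qed.
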